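(* Let $\alpha,\beta,\gamma\in\mathbb{R}$ with $\gamma\neq0$, and let $G_2$ be the connected, simply connected three-dimensional Lie group with left-invariant Lorentzian metric $g$ whose Lie algebra has a pseudo-orthonormal basis $\{\widetilde e_1,\widetilde e_2,\widetilde e_3\}$, with $\widetilde e_3$ timelike, satisfying $$[\widetilde e_1,\widetilde e_2]=\gamma\widetilde e_2-\beta\widetilde e_3,\quad [\widetilde e_1,\widetilde e_3]=-\beta\widetilde e_2-\gamma\widetilde e_3,\quad [\widetilde e_2,\widetilde e_3]=\alpha\widetilde e_1.$$ Then the symmetrized Ricci tensor $\widetilde\rho^c$ of the canonical connection $\nabla^c$ is a Codazzi tensor on $(G_2,\nabla^c)$ if and only if $\gamma\neq0$ and $\alpha=2\beta$.
   Context: Basis vectors are identified with left-invariant vector fields on the group $G$; $g(\widetilde e_1,\widetilde e_1)=g(\widetilde e_2,\widetilde e_2)=1$, $g(\widetilde e_3,\widetilde e_3)=-1$, and $g(\widetilde e_i,\widetilde e_j)=0$ for $i\ne j$. Let $\nabla^L$ be the Levi-Civita connection of $g$ and $J$ the product structure on $G$ (a $(1,1)$ tensor field) with $J\widetilde e_1=\widetilde e_1$, $J\widetilde e_2=\widetilde e_2$, $J\widetilde e_3=-\widetilde e_3$. The canonical connection is $\nabla^c_XY=\nabla^L_XY-\tfrac12(\nabla^L_XJ)JY$, where $(\nabla^L_XJ)Y=\nabla^L_X(JY)-J\nabla^L_XY$. Curvature: $R^c(X,Y)Z=\nabla^c_X\nabla^c_YZ-\nabla^c_Y\nabla^c_XZ-\nabla^c_{[X,Y]}Z$.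 Ricci tensor: $\rho^c(X,Y)=-g(R^c(X,\widetilde e_1)Y,\widetilde e_1)-g(R^c(X,\widetilde e_2)Y,\widetilde e_2)+g(R^c(X,\widetilde e_3)Y,\widetilde e_3)$. Symmetrized Ricci tensor: $\widetilde\rho^c(X,Y)=\tfrac12(\rho^c(X,Y)+\rho^c(Y,X))$. For a linear connection $\nabla$ and a $(0,2)$ tensor field $\omega$: $(\nabla_X\omega)(Y,Z)=X[\omega(Y,Z)]-\omega(\nabla_XY,Z)-\omega(Y,\nabla_XZ)$. The tensor $\omega$ is called a Codazzi tensor on $(G,\nabla)$ if $(\nabla_X\omega)(Y,Z)-(\nabla_Y\omega)(X,Z)=0$ for all vector fields $X,Y,Z$. *)

(* Defs.v *)
From HB Require Import structures.
From mathcomp Require Import all_boot all_order all_algebra.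
From mathcomp Require Import all_classical all_reals all_analysis.
Import Order.TTheory GRing.Theory Num.Theory.
Import numFieldNormedType.Exports.

Set Implicit Arguments.
Unset Strict Implicit.
Unset Printing Implicit Defensive.

Local Open Scope classical_set_scope.
Local Open Scope ring_scope.

(** * Smooth maps between finite-dimensional normed spaces *)

(* Only meaningful for U open.  In finite dimension, requiring all directional
   derivatives to be of class C^k yields the usual class C^(k+1). *)
Fixpoint class_C {R : realType} {E F : normedModType R} (k : nat)
    (U : set E) (f : E -> F) : Prop :=
  match k with
  | 0 => forall x, U x -> {for x, continuous f}
  | k.+1 => (forall x, U x -> differentiable f x) /\
            forall v, class_C k U (fun x => 'D_v f x)
  end.

Definition smooth_on {R : realType} {E F : normedModType R}
    (U : set E) (f : E -> F) : Prop := forall k, class_C k U f.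

Section class_C_theory.
Context {R : realType} {E : normedModType R}.
Implicit Types (U : set E) (f g : E -> R).

Lemma near_eq_differentiable f g (x : E) :
  (\near x, f x = g x) -> differentiable f x -> differentiable g x.
Proof.
move=> fg df; rewrite (_ : g = f + (g - f)); last first.
  by apply/funext => y; rewrite fctE addrC subrK.
apply: differentiableD => //.
have fgx : f x = g x := nbhs_singleton fg.
have gfx : (g - f) x = 0 by rewrite -[LHS]/(g x - f x) fgx subrr.
have fg0 : \forall y \near 0, f (y + x) = g (y + x).
  by move: fg; rewrite (near_shift 0 x) subr0.
have l : (g - f) \o shift x = cst ((g - f) x) + \0 +o_ 0 id.
  apply/eqaddoP => _/posnumP[e]; near=> y.
  rewrite (_ : (_ - _) y = 0) ?normr0 ?mulr_ge0 //.
  rewrite -[LHS]/((g - f) (y + x) - ((g - f) x + 0)) gfx addr0 subr0.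
  rewrite -[LHS]/(g (y + x) - f (y + x)); apply/eqP; rewrite subr_eq0 eq_sym.
  by apply/eqP; near: y.
have c0 : continuous (\0 : E -> R) by move=> y; apply: cst_continuous.
by apply/diff_locallyP; rewrite (diff_unique c0 l).
Unshelve. all: by end_near. Qed.

Lemma class_C_eq k U f g : open U -> (forall x, U x -> f x = g x) ->
  class_C k U f -> class_C k U g.
Proof.
move=> oU; elim: k f g => [|k IH] f g fg.
  move=> cf x Ux; rewrite /prop_for /continuous_at -(fg _ Ux).
  apply: cvg_trans (cf x Ux); apply: near_eq_cvg.
  by apply: filterS (open_nbhs_nbhs (conj oU Ux)) => y /fg.
have nfg x : U x -> \near x, f x = g x.
  by move=> Ux; apply: filterS (open_nbhs_nbhs (conj oU Ux)) => y /fg.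
move=> [df Df]; split=> [x Ux|v].
  exact: near_eq_differentiable (nfg x Ux) (df x Ux).
by apply: IH (Df v) => x Ux; apply: near_eq_derive; exact: nfg.
Qed.

Lemma class_CW k U f : class_C k.+1 U f -> class_C k U f.
Proof.
elim: k f => [|k IH] f [df Df].
  by move=> x Ux; apply: differentiable_continuous; exact: df.
by split=> // v; apply: IH; exact: Df.
Qed.

Lemma class_C_cst k U (a : R) : class_C k U (cst a : E -> R).
Proof.
elim: k a => [|k IH] a; first by move=> x _; exact: cst_continuous.
split=> [x _|v]; first exact: differentiable_cst.
rewrite (_ : (fun x => _) = cst 0); first exact: IH.
by apply/funext => x; rewrite derive_cst.
Qed.

Lemma class_CD k U f g : open U ->
  class_C k U f -> class_C k U g -> class_C k U (f + g).
Proof.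
move=> oU; elim: k f g => [|k IH] f g.
  by move=> cf cg x Ux; apply: continuousD; [exact: cf|exact: cg].
move=> [df Df] [dg Dg]; split=> [x Ux|v].
  by apply: differentiableD; [exact: df|exact: dg].
apply: class_C_eq (IH _ _ (Df v) (Dg v)) => // x Ux.
by rewrite fctE deriveD //; apply: diff_derivable; [exact: df|exact: dg].
Qed.

Lemma class_CM k U f g : open U ->
  class_C k U f -> class_C k U g -> class_C k U (f * g).
Proof.
move=> oU; elim: k f g => [|k IH] f g.
  by move=> cf cg x Ux; apply: continuousM; [exact: cf|exact: cg].
move=> Cf Cg; have [[df Df] [dg Dg]] := (Cf, Cg); split=> [x Ux|v].
  by apply: differentiableM; [exact: df|exact: dg].
have := class_CD oU (IH _ _ (class_CW Cf) (Dg v)) (IH _ _ (class_CW Cg) (Df v)).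
apply: class_C_eq => // x Ux.
by rewrite deriveM //; apply: diff_derivable; [exact: df|exact: dg].
Qed.

End class_C_theory.

(** * Smooth manifolds *)

Record chart (R : realType) (n : nat) (M : topologicalType) := Chart {
  chart_dom : set M;
  chart_fun :> M -> 'rV[R]_n;
  chart_inv : 'rV[R]_n -> M;
  chart_img := chart_fun @` chart_dom;
  chart_dom_open : open chart_dom;
  chart_img_open : open chart_img;
  chart_funK : forall p, chart_dom p -> chart_inv (chart_fun p) = p;
  chart_fun_continuous :
    forall p, chart_dom p -> {for p, continuous chart_fun};
  chart_inv_continuous :
    forall x, chart_img x -> {for x, continuous chart_inv} }.

Record manifold (R : realType) (n : nat) (M : topologicalType) := Manifold {
  atlas : set (chart R n M);
  atlas_cover : forall p, exists2 c, atlas c & chart_dom c p;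
  atlas_compatible : forall c c', atlas c -> atlas c' ->
    smooth_on (c @` (chart_dom c `&` chart_dom c')) (c' \o chart_inv c);
  manifold_hausdorff : hausdorff_space M;
  manifold_second_countable : @second_countable M }.

Section smooth_functions.
Context {R : realType} {n : nat} {M : topologicalType} (A : manifold R n M).

Definition smooth : {pred M -> R} := fun f =>
  `[< forall c, atlas A c -> smooth_on (chart_img c) (f \o chart_inv c) >].

Lemma smooth_subring_closed : subring_closed smooth.
Proof.
split=> [|f g /asboolP sf /asboolP sg|f g /asboolP sf /asboolP sg];
  apply/asboolP => c Ac k.
- exact: class_C_cst.
- rewrite (_ : _ \o _ =
    f \o chart_inv c + (cst (-1)) * (g \o chart_inv c)); last first.
    by apply/funext => x; rewrite !fctE /= mulN1r.
  apply: class_CD; [exact: chart_img_open|exact: sf|].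
  by apply: class_CM; [exact: chart_img_open|exact: class_C_cst|exact: sg].
- by apply: class_CM; [exact: chart_img_open|exact: sf|exact: sg].
Qed.

HB.instance Definition _ := GRing.isSubringClosed.Build (M -> R) smooth
  smooth_subring_closed.

Lemma smooth_scaler_closed : GRing.scaler_closed smooth.
Proof.
move=> a f /asboolP sf; apply/asboolP => c Ac k.
by apply: class_CM; [exact: chart_img_open|exact: class_C_cst|exact: sf].
Qed.

HB.instance Definition _ := GRing.isScaleClosed.Build R (M -> R) smooth
  smooth_scaler_closed.

Record smooth_fun := SmoothFun { sfun :> M -> R ; sfunP : sfun \in smooth }.

HB.instance Definition _ := [isSub for sfun].
HB.instance Definition _ := [Choice of smooth_fun by <:].
HB.instance Definition _ :=
  GRing.SubChoice_isSubComPzRing.Build (M -> R) smooth smooth_fun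
    smooth_subring_closed.
HB.instance Definition _ := [SubZmodule_isSubLmodule of smooth_fun by <:].

End smooth_functions.

(** * Vector fields and tensors *)

Section vector_fields.
Context {R : realType} {n : nat} {M : topologicalType} (A : manifold R n M).
Local Notation Coo := (smooth_fun A).
Local Notation operator := (Coo -> Coo).
Implicit Types (f h : Coo) (X Y Z : operator) (g : operator -> operator -> Coo).

(* A vector field is identified with its action on smooth functions: in each
   chart it is sum_i a_i d/dx_i with smooth components a_i. *)
Definition vector_field X : Prop :=
  forall c, atlas A c -> exists a : 'I_n -> 'rV[R]_n -> R,
    (forall i, smooth_on (chart_img c) (a i)) /\
    forall f p, chart_dom c p ->
      X f p = \sum_i a i (c p) * 'D_(delta_mx 0 i) (f \o chart_inv c) (c p).

(* Sums and real multiples of vector fields are the pointwise ones of functions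
   smooth_fun A -> smooth_fun A; this is multiplication by a smooth function. *)
Definition vscale f X : operator := fun h => f * X h.

Definition lie_bracket X Y : operator := fun f => X (Y f) - Y (X f).

(* Tensor fields are maps on vector fields that are linear over smooth
   functions; their values on other operators are irrelevant. *)
Definition tensor02 g : Prop :=
  (forall f X Y Z, vector_field X -> vector_field Y -> vector_field Z ->
    g (vscale f X + Y) Z = f * g X Z + g Y Z) /\
  (forall f X Y Z, vector_field X -> vector_field Y -> vector_field Z ->
    g X (vscale f Y + Z) = f * g X Y + g X Z).

Definition tensor11 (J : operator -> operator) : Prop :=
  (forall X, vector_field X -> vector_field (J X)) /\
  (forall f X Y, vector_field X -> vector_field Y ->
    J (vscale f X + Y) = vscale f (J X) + J Y).

Definition product_structure (J : operator -> operator) : Prop :=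
  tensor11 J /\ forall X, vector_field X -> J (J X) = X.

(** * Linear connections *)

Implicit Types nabla : operator -> operator -> operator.

Definition linear_connection nabla : Prop :=
  [/\ forall X Y, vector_field X -> vector_field Y -> vector_field (nabla X Y),
      forall f X Y Z, vector_field X -> vector_field Y -> vector_field Z ->
        nabla (vscale f X + Y) Z = vscale f (nabla X Z) + nabla Y Z,
      forall X Y Z, vector_field X -> vector_field Y -> vector_field Z ->
        nabla X (Y + Z) = nabla X Y + nabla X Z &
      forall f X Y, vector_field X -> vector_field Y ->
        nabla X (vscale f Y) = vscale (X f) Y + vscale f (nabla X Y)].

Definition torsion_free nabla : Prop :=
  forall X Y, vector_field X -> vector_field Y ->
    nabla X Y - nabla Y X = lie_bracket X Y.

Definition cov_deriv02 nabla (omega : operator -> operator -> Coo) X Y Z : Coo :=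
  X (omega Y Z) - omega (nabla X Y) Z - omega Y (nabla X Z).

Definition metric_compatible g nabla : Prop :=
  forall X Y Z, vector_field X -> vector_field Y -> vector_field Z ->
    cov_deriv02 nabla g X Y Z = 0.

Definition levi_civita g nabla : Prop :=
  [/\ linear_connection nabla, torsion_free nabla & metric_compatible g nabla].

Definition cov_deriv11 nabla (J : operator -> operator) X Y : operator :=
  nabla X (J Y) - J (nabla X Y).

Definition canonical_connection nabla (J : operator -> operator) X Y : operator :=
  nabla X Y - 2^-1 *: cov_deriv11 nabla J X (J Y).

Definition curvature nabla X Y Z : operator :=
  nabla X (nabla Y Z) - nabla Y (nabla X Z) - nabla (lie_bracket X Y) Z.

(* Ricci tensor in a pseudo-orthonormal frame e1, e2, e3 with e3 timelike. *)
Definition ricci g nabla (e1 e2 e3 : operator) X Y : Coo :=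
  - g (curvature nabla X e1 Y) e1 - g (curvature nabla X e2 Y) e2
  + g (curvature nabla X e3 Y) e3.

Definition sym_ricci g nabla (e1 e2 e3 : operator) X Y : Coo :=
  2^-1 *: (ricci g nabla e1 e2 e3 X Y + ricci g nabla e1 e2 e3 Y X).

Definition codazzi nabla (omega : operator -> operator -> Coo) : Prop :=
  forall X Y Z, vector_field X -> vector_field Y -> vector_field Z ->
    cov_deriv02 nabla omega X Y Z - cov_deriv02 nabla omega Y X Z = 0.

(* At the point p; e3 is timelike. *)
Definition pseudo_orthonormal g (e1 e2 e3 : operator) (p : M) : Prop :=
  [/\ g e1 e1 p = 1, g e2 e2 p = 1, g e3 e3 p = -1 &
      [/\ g e1 e2 p = 0, g e2 e1 p = 0, g e1 e3 p = 0 &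
      [/\ g e3 e1 p = 0, g e2 e3 p = 0 & g e3 e2 p = 0]]].

End vector_fields.

(* In dimension three, a triple that is pseudo-orthonormal at p is a basis of
   the tangent space at p, so the last condition says that g has signature
   (2,1) at every point. *)
Definition lorentzian3 {R : realType} {M : topologicalType}
    {A : manifold R 3 M}
    (g : (smooth_fun A -> smooth_fun A) -> (smooth_fun A -> smooth_fun A) ->
         smooth_fun A) : Prop :=
  [/\ tensor02 g,
      forall X Y, vector_field X -> vector_field Y -> g X Y = g Y X &
      forall p, exists X1 X2 X3 : smooth_fun A -> smooth_fun A,
        [/\ vector_field X1, vector_field X2, vector_field X3 &
            pseudo_orthonormal g X1 X2 X3 p]].

(** * Lie groups *)

#[short(type="topGroupType")]
HB.structure Definition TopGroup := {G of Group G & Topological G}.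

Record lie_group (R : realType) (n : nat) (G : topGroupType) := LieGroup {
  lie_group_manifold :> manifold R n G;
  mul_continuous : continuous (fun p : G * G => (p.1 * p.2)%g);
  inv_continuous : continuous (fun p : G => p^-1%g);
  mul_smooth : forall c1 c2 c3, atlas lie_group_manifold c1 ->
    atlas lie_group_manifold c2 -> atlas lie_group_manifold c3 ->
    smooth_on [set (c1 p.1, c2 p.2) | p in
                 [set p : G * G | [/\ chart_dom c1 p.1, chart_dom c2 p.2 &
                                      chart_dom c3 (p.1 * p.2)%g]]]
      (fun u => c3 (chart_inv c1 u.1 * chart_inv c2 u.2)%g);
  inv_smooth : forall c1 c2, atlas lie_group_manifold c1 ->
    atlas lie_group_manifold c2 ->
    smooth_on [set c1 p | p in
                 [set p : G | chart_dom c1 p /\ chart_dom c2 p^-1%g]]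
      (fun u => c2 (chart_inv c1 u)^-1%g) }.

Section lie_groups.
Context {R : realType} {n : nat} {G : topGroupType} (L : lie_group R n G).
Local Notation Coo := (smooth_fun L).
Local Notation operator := (Coo -> Coo).

(* X (f \o left translation by a) = (X f) \o left translation by a; here h is
   the smooth function f \o left translation by a. *)
Definition left_invariant (X : operator) : Prop :=
  forall (a : G) (f h : Coo), (forall p, h p = f (a * p)%g) ->
    forall p, X h p = X f (a * p)%g.

Definition lie_algebra (X : operator) : Prop :=
  vector_field X /\ left_invariant X.

Definition lie_algebra_basis3 (e1 e2 e3 : operator) : Prop :=
  [/\ lie_algebra e1, lie_algebra e2, lie_algebra e3 &
      forall X, lie_algebra X ->
        exists! a : R * R * R, X = a.1.1 *: e1 + a.1.2 *: e2 + a.2 *: e3].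

(* Left translations are isometries of g, expressed on left-invariant fields. *)
Definition left_invariant_metric (g : operator -> operator -> Coo) : Prop :=
  forall X Y, lie_algebra X -> lie_algebra Y -> forall p q, g X Y p = g X Y q.

End lie_groups.

Definition simply_connected (R : realType) (M : topologicalType) : Prop :=
  forall gamma : R -> M, {within `[0, 1], continuous gamma} ->
    gamma 0 = gamma 1 ->
    exists H : R * R -> M,
      [/\ {within `[0, 1] `*` `[0, 1], continuous H},
          forall s, s \in `[0, 1] -> H (s, 0) = gamma s /\ H (s, 1) = gamma 0 &
          forall t, t \in `[0, 1] -> H (0, t) = gamma 0 /\ H (1, t) = gamma 0].

(* Main.v *)
Require Import Defs.
From HB Require Import structures.
From mathcomp Require Import all_boot all_order all_algebra.
From mathcomp Require Import all_classical all_reals all_analysis.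
From mathcomp Require Import ring.
Import Order.TTheory GRing.Theory Num.Theory.
Import numFieldNormedType.Exports.
Local Open Scope classical_set_scope.
Local Open Scope ring_scope.

Set Implicit Arguments.
Unset Strict Implicit.

(** Since nabla is metric, its connection matrix in the frame e1, e2, e3 is
skew for g.  The canonical connection D = (nabla + J nabla J) / 2 keeps only the
entries of that matrix that commute with J, that is, a single 1-form th:
  D_X e1 = th(X) e2,   D_X e2 = - th(X) e1,   D_X e3 = 0.
Being torsion-free and metric, nabla gives th(e1) = 0, th(e2) = - gamma and
th(e3) = alpha / 2 from the brackets.  The curvature of D is the rotation of
span(e1, e2) by d th, where
  d th(e1, e2) = gamma^2 + alpha beta / 2 =: k,
  d th(e1, e3) = gamma (alpha / 2 - beta) =: 2 m,     d th(e2, e3) = 0.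
In the coordinates x, y of X, Y in the frame, the symmetrized Ricci tensor is
therefore
  S(X, Y) = - k (x1 y1 + x2 y2) - m (x2 y3 + x3 y2).
The first part is invariant under rotations of span(e1, e2), hence D-parallel,
so (D_X S)(Y, Z) = m th(X) (y1 z3 + y3 z1).  On (e1, e2, e3) the Codazzi
condition reads m gamma = 0, that is, m = 0 because gamma is nonzero; and if
m = 0, then S is parallel.  As gamma is nonzero, m = 0 means alpha = 2 beta.

All these computations are made with arbitrary vector fields, written as
combinations of e1, e2, e3 with smooth coefficients.  That such coefficients
exist is the analytic part ([frame_expansion]).  A combination of the e_i with
real coefficients that kills all functions at one point kills them at every
point, by left translation ([left_invariant_eq0]), so it is zero.  Hence the
matrix of components of the e_i in a chart is invertible, and Cramer's formula
gives coefficients that are smooth in each chart.  They are independent of the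
chart because they are unique at each point, so no partition of unity is
required. *)

(** * Calculus of maps of class C^k *)

Section class_C_calculus.
Context {R : realType}.

Lemma class_C_local {E F : normedModType R} k (U : set E) (f : E -> F) :
  (forall x, U x -> exists2 V : set E, V x & class_C k V f) -> class_C k U f.
Proof.
elim: k f => [|k IH] f H; first by move=> x /H[V Vx cf]; exact: (cf x Vx).
split=> [x /H[V Vx [df _]]|v]; first exact: df.
by apply: IH => x /H[V Vx [_ Df]]; exists V => //; exact: Df.
Qed.

Lemma class_C_subset {E F : normedModType R} k (U V : set E) (f : E -> F) :
  U `<=` V -> class_C k V f -> class_C k U f.
Proof. by move=> UV CV; apply: class_C_local => x /UV Vx; exists V. Qed.

(** The version of [class_CW] for maps with values in a normed module, such as
the inner map of a composite. *)
Lemma class_C_pred {E F : normedModType R} k (U : set E) (f : E -> F) :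
  class_C k.+1 U f -> class_C k U f.
Proof.
elim: k f => [|k IH] f [df Df].
  by move=> x Ux; exact/differentiable_continuous/df.
by split=> // v; apply: IH; exact: Df.
Qed.

Lemma class_C_sum {E : normedModType R} k (U : set E) I (r : seq I)
    (P : pred I) (f : I -> E -> R) : open U ->
  (forall i, class_C k U (f i)) ->
  class_C k U (fun x => \sum_(i <- r | P i) f i x).
Proof.
move=> oU Cf; rewrite (_ : (fun x => _) = \sum_(i <- r | P i) f i).
  apply: (big_ind (class_C k U)) => //; first exact: class_C_cst.
  by move=> ? ? ? ?; apply: class_CD.
by apply/funext => x; rewrite fct_sumE.
Qed.

Lemma class_C_prod {E : normedModType R} k (U : set E) I (r : seq I)
    (P : pred I) (f : I -> E -> R) : open U ->
  (forall i, class_C k U (f i)) ->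
  class_C k U (fun x => \prod_(i <- r | P i) f i x).
Proof.
move=> oU Cf; rewrite (_ : (fun x => _) = \prod_(i <- r | P i) f i).
  apply: (big_ind (class_C k U)) => //; first exact: class_C_cst.
  by move=> ? ? ? ?; apply: class_CM.
by apply/funext => x; rewrite fct_prodE.
Qed.

Lemma class_C_det {E : normedModType R} k (U : set E) n (M : E -> 'M[R]_n) :
  open U -> (forall i j, class_C k U (fun x => M x i j)) ->
  class_C k U (fun x => \det (M x)).
Proof.
move=> oU CM; apply: class_C_sum => // s.
by apply: class_CM => //; [exact: class_C_cst|exact: class_C_prod].
Qed.

Lemma class_C_cofactor {E : normedModType R} k (U : set E) n
    (M : E -> 'M[R]_n) i j :
  open U -> (forall i j, class_C k U (fun x => M x i j)) ->
  class_C k U (fun x => cofactor (M x) i j).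
Proof.
move=> oU CM; apply: class_CM => //; first exact: class_C_cst.
apply: class_C_det => // i' j'.
by under eq_fun do rewrite !mxE.
Qed.

(** The derivative of 1 / f is - f' / f^2, a product of functions that the
induction already controls. *)
Lemma class_CV {E : normedModType R} k (U : set E) (f : E -> R) :
  open U -> (forall x, U x -> f x != 0) ->
  class_C k U f -> class_C k U (fun x => (f x)^-1).
Proof.
move=> oU f0; elim: k => [|k IH] Cf.
  by move=> x Ux; apply: continuousV; [exact: f0|exact: Cf].
have [df Df] := Cf; split=> [x Ux|v].
  by apply: differentiableV; [exact: df|exact: f0].
have CV := IH (class_CW Cf).
have := class_CM oU (class_C_cst k U (-1))
  (class_CM oU (class_CM oU CV CV) (Df v)).
apply: class_C_eq => // x Ux.
rewrite deriveV; [|exact: f0|exact/diff_derivable/df].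
by rewrite !fctE /= -exprVn expr2 mulN1r /GRing.scale/= mulNr.
Qed.

Lemma class_C_coord {E : normedModType R} k (U : set E) n
    (phi : E -> 'rV[R]_n) i : open U ->
  class_C k U phi -> class_C k U (fun x => phi x 0 i).
Proof.
move=> oU; elim: k phi => [|k IH] phi.
  move=> cphi x Ux.
  apply: (@continuous_comp _ _ _ phi (fun y : 'rV_n => y 0 i)).
    exact: cphi.
  exact: coord_continuous.
move=> [dphi Dphi]; split=> [x Ux|v].
  exact: (differentiable_comp (dphi x Ux) (differentiable_coord _ _ _)).
apply: class_C_eq (IH _ (Dphi v)) => // x Ux.
by rewrite derive_mx ?mxE//; exact/diff_derivable/dphi.
Qed.

(** The chain rule expresses the partial derivatives of a composite through
products and sums of functions of class C^k, which makes the induction go. *)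
Lemma class_C_comp {E : normedModType R} k n (U : set E) (V : set 'rV[R]_n)
    (phi : E -> 'rV[R]_n) (F : 'rV[R]_n -> R) : open U ->
  (forall x, U x -> V (phi x)) -> class_C k U phi -> class_C k V F ->
  class_C k U (F \o phi).
Proof.
move=> oU UV; elim: k F => [|k IH] F.
  move=> cphi cF x Ux; apply: (continuous_comp (cphi x Ux)).
  exact: cF (UV x Ux).
move=> Cphi CF; have [[dphi Dphi] [dF DF]] := (Cphi, CF).
split=> [x Ux|v].
  by apply: differentiable_comp; [exact: dphi|exact/dF/UV].
have Cphik : class_C k U phi by exact: class_C_pred.
have : class_C k U (fun x => \sum_i 'D_v phi x 0 i *
    ((fun y => 'D_(delta_mx 0 i) F y) \o phi) x).
  apply: class_C_sum => // i; apply: class_CM => //.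
    exact: (class_C_coord _ oU (Dphi v)).
  exact: IH Cphik (DF _).
apply: class_C_eq => // x Ux.
have dFx : differentiable F (phi x) by exact/dF/UV.
have dpx := dphi x Ux.
rewrite [RHS]deriveE; last exact: differentiable_comp.
rewrite (diff_comp dpx dFx) /= -(deriveE v dpx).
rewrite [in RHS](row_sum_delta ('D_v phi x)).
rewrite linear_sum; apply: eq_bigr => i _.
by rewrite linearZ /= -(deriveE _ dFx).
Qed.

(** A directional derivative of a slice is the slice of a directional
derivative, the direction having first component 0. *)
Lemma class_C_slice {E1 E2 F : normedModType R} k (W : set (E1 * E2))
    (Phi : E1 * E2 -> F) (w : E1) :
  class_C k W Phi -> class_C k [set u | W (w, u)] (fun u => Phi (w, u)).
Proof.
have dpair u : differentiable (fun u : E2 => (w, u)) u.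
  by apply: differentiable_pair; [exact: differentiable_cst|].
elim: k Phi => [|k IH] Phi.
  move=> cPhi u Wu; apply: continuous_comp (cPhi _ Wu).
  exact/differentiable_continuous/dpair.
move=> [dPhi DPhi]; split=> [u Wu|v].
  exact: (differentiable_comp (dpair u) (dPhi _ Wu)).
rewrite (_ : (fun u => _) = fun u => 'D_(0, v) Phi (w, u)).
  exact: (IH _ (DPhi (0, v))).
apply/funext => u; apply: (congr1 (fun q : R -> F => lim (q @ 0^'))).
apply/funext => h /=.
have -> // : h *: (0, v) + (w, u) = (w, h *: v + u) :> E1 * E2.
by congr pair; rewrite /= scaler0 add0r.
Qed.

End class_C_calculus.

(** * Smooth functions and vector fields *)

Section vector_fields.
Context {R : realType} {n : nat} {M : topologicalType} {A : manifold R n M}.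
Local Notation Coo := (smooth_fun A).
Implicit Types (f h : Coo) (X Y : Coo -> Coo).

Lemma smooth_fun_ext f h : (forall p, f p = h p) -> f = h.
Proof. by move=> fh; apply: val_inj; apply/funext. Qed.

Lemma smooth_fun_sum I (r : seq I) (P : pred I) (F : I -> Coo) p :
  (\sum_(i <- r | P i) F i) p = \sum_(i <- r | P i) F i p.
Proof. by elim/big_rec2: _ => //= i _ y _ <-. Qed.

Lemma operator_sum I (r : seq I) (P : pred I) (F : I -> Coo -> Coo) f p :
  (\sum_(i <- r | P i) F i) f p = \sum_(i <- r | P i) F i f p.
Proof. by rewrite fct_sumE smooth_fun_sum. Qed.

Lemma smooth_funP f c : atlas A c -> smooth_on (chart_img c) (f \o chart_inv c).
Proof. by move=> Ac; have /asboolP := sfunP f; apply. Qed.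

Lemma differentiable_chart f c p : atlas A c -> chart_dom c p ->
  differentiable (f \o chart_inv c) (c p).
Proof.
by move=> Ac cp; have [df _] := smooth_funP f Ac 1; apply: df; exists p.
Qed.

Lemma vector_field0 : vector_field (0 : Coo -> Coo).
Proof.
move=> c Ac; exists (fun=> cst 0); split=> [i k|f p cp].
  exact: class_C_cst.
by rewrite big1 // => i _; rewrite mul0r.
Qed.

Lemma vector_fieldD X Y :
  vector_field X -> vector_field Y -> vector_field (X + Y).
Proof.
move=> vX vY c Ac; have [a [Ca aE]] := vX c Ac; have [b [Cb bE]] := vY c Ac.
exists (fun i => a i + b i); split=> [i k|f p cp].
  by apply: class_CD; [exact: chart_img_open|exact: Ca|exact: Cb].
rewrite -[LHS]/(X f p + Y f p) aE // bE // -big_split /=.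
by apply: eq_bigr => i _; rewrite -mulrDl.
Qed.

Lemma vector_field_vscale f X : vector_field X -> vector_field (vscale f X).
Proof.
move=> vX c Ac; have [a [Ca aE]] := vX c Ac.
exists (fun i => (f \o chart_inv c) * a i); split=> [i k|h p cp].
  by apply: class_CM; [exact: chart_img_open|exact: smooth_funP|exact: Ca].
rewrite -[LHS]/(f p * X h p) aE // big_distrr /=; apply: eq_bigr => i _.
by rewrite mulrA [in RHS]fctE /= chart_funK.
Qed.

Lemma vector_fieldM X f h : vector_field X -> X (f * h) = X f * h + f * X h.
Proof.
move=> vX; apply: smooth_fun_ext => p.
have [c Ac cp] := atlas_cover A p; have [a [_ aE]] := vX c Ac.
rewrite -[RHS]/(X f p * h p + f p * X h p) !aE // big_distrl big_distrr /=.
rewrite -big_split /=; apply: eq_bigr => i _.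
rewrite (_ : (f * h)%R \o chart_inv c =
  (f \o chart_inv c) * (h \o chart_inv c)) //.
rewrite deriveM; do ?exact/diff_derivable/differentiable_chart.
by rewrite /GRing.scale /= chart_funK //; ring.
Qed.

Lemma vector_field_additive X f h : vector_field X -> X (f + h) = X f + X h.
Proof.
move=> vX; apply: smooth_fun_ext => p.
have [c Ac cp] := atlas_cover A p; have [a [_ aE]] := vX c Ac.
rewrite -[RHS]/(X f p + X h p) !aE // -big_split /=; apply: eq_bigr => i _.
rewrite (_ : (f + h)%R \o chart_inv c =
  (f \o chart_inv c) + (h \o chart_inv c)) //.
by rewrite deriveD ?mulrDr//; exact/diff_derivable/differentiable_chart.
Qed.

Lemma vector_field_scalar X (a : R) : vector_field X -> X (a *: (1 : Coo)) = 0.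
Proof.
move=> vX; apply: smooth_fun_ext => p.
have [c Ac cp] := atlas_cover A p; have [b [_ bE]] := vX c Ac.
rewrite bE // big1 // => i _.
by rewrite (_ : _ \o _ = cst (a * 1)) // derive_cst mulr0.
Qed.

Lemma operatorDE X Y f : (X + Y) f = X f + Y f. Proof. by []. Qed.
Lemma operatorNE X f : (- X) f = - X f. Proof. by []. Qed.
Lemma operatorZE (a : R) X f : (a *: X) f = (a *: (1 : Coo)) * X f.
Proof.
apply: smooth_fun_ext => p.
by rewrite -[LHS]/(a * X f p) -[RHS]/(a * 1 * X f p) mulr1.
Qed.
Lemma vscaleE f X h : vscale f X h = f * X h. Proof. by []. Qed.

Lemma vector_field_zero X : vector_field X -> X 0 = 0.
Proof. by move=> vX; have := vector_field_scalar 0 vX; rewrite scale0r. Qed.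

Lemma vector_fieldN X f : vector_field X -> X (- f) = - X f.
Proof.
move=> vX; apply/eqP; rewrite -addr_eq0 -vector_field_additive // addNr.
by rewrite vector_field_zero.
Qed.

Lemma vector_fieldB X Y :
  vector_field X -> vector_field Y -> vector_field (X - Y).
Proof.
move=> vX vY; rewrite (_ : X - Y = X + vscale (-1) Y).
  by apply: vector_fieldD => //; exact: vector_field_vscale.
by apply/funext => h; rewrite !operatorDE operatorNE vscaleE; ring.
Qed.

Lemma vector_field_one X : vector_field X -> X 1 = 0.
Proof. by move=> vX; have := vector_field_scalar 1 vX; rewrite scale1r. Qed.

Lemma halfD f : 2^-1 *: (f + f) = f.
Proof.
by apply: smooth_fun_ext => p; rewrite -[LHS]/(2^-1 * (f p + f p)); field.
Qed.

Lemma eq_oppr0 f : f = - f -> f = 0.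
Proof.
move=> fN; rewrite -[f]halfD {2}fN subrr.
by apply: smooth_fun_ext => p; exact: mulr0.
Qed.

End vector_fields.

(** * Left-invariant frames *)

Section left_invariant_frames.
Context {R : realType} {n : nat} {G : topGroupType} {L : lie_group R n G}.
Local Notation Coo := (smooth_fun L).
Implicit Types (f h : Coo) (X E : Coo -> Coo).

(** In charts c1 around a, c around p and c3 around a p, the translated function
is the composite of f with a slice of the multiplication. *)
Lemma smooth_translate (a : G) f : exists h : Coo, forall p, h p = f (a * p)%g.
Proof.
suff sh : (fun p => f (a * p)%g) \in smooth L by exists (SmoothFun sh).
apply/asboolP => c Ac k; apply: class_C_local => _ [p cp <-].
have [c1 Ac1 c1a] := atlas_cover L a.
have [c3 Ac3 c3ap] := atlas_cover L (a * p)%g.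
pose V := [set u | chart_img c u /\ chart_dom c3 (a * chart_inv c u)%g].
exists V; first by split; [exists p|rewrite chart_funK].
have oV : open V.
  rewrite openE => u [cu c3u]; apply: filterI.
    by apply: open_nbhs_nbhs; split=> //; exact: chart_img_open.
  have ca : {for u, continuous (fun u => (a * chart_inv c u)%g)}.
    apply: (@continuous_comp _ _ _ (chart_inv c) (fun p => (a * p)%g)).
      exact: chart_inv_continuous.
    apply: (@continuous_comp _ _ _ (fun q : G => (a, q))
              (fun p : G * G => (p.1 * p.2)%g)).
      by apply: cvg_pair => //; exact: cvg_cst.
    exact: (Defs.mul_continuous L).
  apply: ca; apply: open_nbhs_nbhs; split=> //; exact: chart_dom_open.
pose phi u := c3 (chart_inv c1 (c1 a) * chart_inv c u)%g.
have : class_C k V ((f \o chart_inv c3) \o phi).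
  apply: (@class_C_comp _ _ _ _ _ (chart_img c3)) => //.
  - move=> u [_ c3u]; exists (a * chart_inv c u)%g => //.
    by rewrite /phi chart_funK.
  - have := class_C_slice (c1 a) (mul_smooth Ac1 Ac Ac3 k).
    apply: class_C_subset => _ [[q cq <-] c3q].
    rewrite chart_funK // in c3q.
    by exists (a, q).
  - exact: smooth_funP.
apply: class_C_eq => // u [_ c3u].
by rewrite /phi /= !chart_funK.
Qed.

(** The translation by q p^-1 moves a function with its value at q to one with
the same value at p, so vanishing at p propagates to every point q. *)
Lemma left_invariant_eq0 E p : left_invariant E ->
  (forall f, E f p = 0) -> E = 0.
Proof.
move=> iE E0; apply/funext => f; apply: smooth_fun_ext => q.
have [h hE] := smooth_translate (q * p^-1)%g f.
by have := iE _ _ _ hE p; rewrite E0 mulgVK => <-.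
Qed.

Context (e : 'I_n -> Coo -> Coo).
Context (e_lie : forall i, lie_algebra (e i)).
Context (e_free : forall v : 'rV[R]_n, \sum_i v 0 i *: e i = 0 -> v = 0).

Lemma frame_pointwise_free (v : 'rV[R]_n) p :
  (forall f, \sum_i v 0 i * e i f p = 0) -> v = 0.
Proof.
move=> v0; apply: e_free; apply: (@left_invariant_eq0 _ p) => [a f h hE q|f].
  rewrite !operator_sum; apply: eq_bigr => i _; congr (_ * _).
  exact: (e_lie i).2.
by rewrite operator_sum; exact: v0.
Qed.

(** In a chart, Cramer's formula for the matrix of components of the e_i gives
the coefficients of X as smooth functions.  These local formulas define one
global function because the e_i are independent at each point. *)
Lemma frame_expansion X : vector_field X ->
  exists x : 'I_n -> Coo, X = \sum_i vscale (x i) (e i).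
Proof.
move=> vX.
(* The components a of the e_i and b of X are 0 for charts outside the atlas,
   so that they are defined for every chart. *)
have /choice[a aP] c : exists a : 'I_n -> 'I_n -> 'rV[R]_n -> R, atlas L c ->
    forall i, (forall j, smooth_on (chart_img c) (a i j)) /\
      forall f p, chart_dom c p -> e i f p =
        \sum_j a i j (c p) * 'D_(delta_mx 0 j) (f \o chart_inv c) (c p).
  have [Ac|nAc] := pselect (atlas L c); last by exists (fun _ _ => cst 0).
  by have /choice[a aP] := fun i => (e_lie i).1 c Ac; exists a.
have /choice[b bP] c : exists b : 'I_n -> 'rV[R]_n -> R, atlas L c ->
    (forall j, smooth_on (chart_img c) (b j)) /\
      forall f p, chart_dom c p -> X f p =
        \sum_j b j (c p) * 'D_(delta_mx 0 j) (f \o chart_inv c) (c p).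
  have [Ac|nAc] := pselect (atlas L c); last by exists (fun _ => cst 0).
  by have [b ?] := vX c Ac; exists b.
pose m c u : 'M[R]_n := \matrix_(i, j) a c i j u.
pose r c u : 'rV[R]_n := \row_j b c j u.
(* A row vector in the kernel of m is a combination of the e_i that vanishes at
   a point. *)
have m_unit c u : atlas L c -> chart_img c u -> \det (m c u) != 0.
  move=> Ac [p cp <-]; apply/det0P => -[v v0 vm0]; move/eqP: v0; apply.
  apply: (@frame_pointwise_free _ p) => f.
  under eq_bigr => i _ do rewrite ((aP c Ac i).2 f p cp) big_distrr /=.
  rewrite exchange_big big1 //= => j _.
  have vmj : \sum_i v 0 i * a c i j (c p) = 0.
    have /matrixP/(_ 0 j) := vm0; rewrite !mxE => vm0j; rewrite -[RHS]vm0j.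
    by apply: eq_bigr => i _; rewrite mxE.
  under eq_bigr do rewrite mulrA.
  by rewrite -big_distrl /= vmj mul0r.
pose y c u : 'rV[R]_n := r c u *m invmx (m c u).
have yP c p : atlas L c -> chart_dom c p ->
    forall f, X f p = \sum_i y c (c p) 0 i * e i f p.
  move=> Ac cp f; rewrite (bP c Ac).2 //.
  under [RHS]eq_bigr => i _ do rewrite ((aP c Ac i).2 f p cp) big_distrr /=.
  rewrite exchange_big; apply: eq_bigr => j _ /=.
  under eq_bigr do rewrite mulrA.
  rewrite -big_distrl /=; congr (_ * _).
  have : y c (c p) *m m c (c p) = r c (c p).
    by rewrite /y mulmxKV // unitmxE unitfE m_unit //; exists p.
  move=> /matrixP/(_ 0 j); rewrite !mxE => <-.
  by apply: eq_bigr => i _; rewrite !mxE.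
have /choice[x xP] p : exists x : 'rV[R]_n,
    forall f, X f p = \sum_i x 0 i * e i f p.
  by have [c Ac cp] := atlas_cover L p; exists (y c (c p)); exact: yP.
(* The coefficients chosen at p agree with those of every chart around p. *)
have xy c p : atlas L c -> chart_dom c p -> x p = y c (c p).
  move=> Ac cp; apply/eqP; rewrite -subr_eq0; apply/eqP.
  apply: (@frame_pointwise_free _ p) => f.
  under eq_bigr do rewrite mxE [X in _ + X]mxE mulrBl.
  by rewrite sumrB -xP -(yP c p Ac cp) subrr.
have sx i : (fun p => x p 0 i) \in smooth L.
  apply/asboolP => c Ac k.
  have oc : open (chart_img c) by exact: chart_img_open.
  have Cm i' j : class_C k (chart_img c) (fun u => m c u i' j).
    by under eq_fun do rewrite mxE; exact: (aP c Ac i').1.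
  have : class_C k (chart_img c) (fun u => (\det (m c u))^-1 *
      \sum_j r c u 0 j * cofactor (m c u) i j).
    apply: class_CM => //.
      apply: class_CV => //; last exact: class_C_det.
      by move=> u cu; exact: m_unit.
    apply: class_C_sum => // j; apply: class_CM => //.
      by under eq_fun do rewrite mxE; exact: (bP c Ac).1.
    exact: class_C_cofactor.
  apply: class_C_eq => // _ [p cp <-] /=.
  rewrite chart_funK // (xy c) // /y /invmx unitmxE unitfE m_unit; last first.
  - by exists p.
  - by [].
  rewrite -scalemxAr !mxE; congr (_ * _).
  by apply: eq_bigr => j _; rewrite !mxE.
exists (fun i => SmoothFun (sx i)).
apply/funext => f; apply: smooth_fun_ext => p.
by rewrite xP operator_sum.
Qed.

End left_invariant_frames.

(** * The canonical connection in a pseudo-orthonormal frame *)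

Section frame_geometry.
Context {R : realType} {n : nat} {M : topologicalType} {A : manifold R n M}.
Local Notation Coo := (smooth_fun A).
Local Notation operator := (Coo -> Coo).
Implicit Types (f h : Coo) (X Y Z : operator).

(** Tensoriality in one argument.  Operator-valued tensors such as J are covered
by evaluating their value at a fixed function. *)
Definition function_linear (T : operator -> Coo) := forall f X Y,
  vector_field X -> vector_field Y -> T (vscale f X + Y) = f * T X + T Y.

Lemma function_linear0 T : function_linear T -> T 0 = 0.
Proof.
move=> lT; have := lT 1 0 0 vector_field0 vector_field0.
rewrite (_ : vscale 1 0 + 0 = 0) ?mul1r; last first.
  by apply/funext => h; rewrite -[LHS]/(1 * 0 + 0) mulr0 addr0.
by move/eqP; rewrite -subr_eq subrr eq_sym => /eqP.
Qed.

Lemma function_linearZ T f X : function_linear T -> vector_field X ->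
  T (vscale f X) = f * T X.
Proof.
move=> lT vX; rewrite -[vscale f X]addr0 lT ?function_linear0 ?addr0 //.
exact: vector_field0.
Qed.

Context (e1 e2 e3 : operator).
Context (v1 : vector_field e1) (v2 : vector_field e2) (v3 : vector_field e3).

Definition frame (x1 x2 x3 : Coo) : operator :=
  vscale x1 e1 + (vscale x2 e2 + vscale x3 e3).

Lemma vector_field_frame x1 x2 x3 : vector_field (frame x1 x2 x3).
Proof. by do !apply: vector_fieldD; apply: vector_field_vscale. Qed.
Hint Resolve vector_field_frame v1 v2 v3 : core.

Lemma frameE x1 x2 x3 f : frame x1 x2 x3 f = x1 * e1 f + x2 * e2 f + x3 * e3 f.
Proof. exact: addrA. Qed.

Lemma frame_linear T x1 x2 x3 : function_linear T ->
  T (frame x1 x2 x3) = x1 * T e1 + x2 * T e2 + x3 * T e3.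
Proof.
move=> lT; have v3' := vector_field_vscale x3 v3.
rewrite lT ?lT ?function_linearZ ?addrA //.
by apply: vector_fieldD => //; exact: vector_field_vscale.
Qed.

Lemma frameB x1 x2 x3 y1 y2 y3 :
  frame x1 x2 x3 - frame y1 y2 y3 = frame (x1 - y1) (x2 - y2) (x3 - y3).
Proof.
apply/funext => h; rewrite -[LHS]/(frame x1 x2 x3 h - frame y1 y2 y3 h) !frameE.
by ring.
Qed.

Lemma half_frame x1 x2 x3 :
  2^-1 *: frame (x1 + x1) (x2 + x2) (x3 + x3) = frame x1 x2 x3.
Proof.
apply/funext => h; rewrite -[RHS]halfD; congr (_ *: _).
by rewrite !frameE; ring.
Qed.

Lemma frame100 : e1 = frame 1 0 0.
Proof. by apply/funext => h; rewrite frameE; ring. Qed.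
Lemma frame010 : e2 = frame 0 1 0.
Proof. by apply/funext => h; rewrite frameE; ring. Qed.

Context (span : forall X, vector_field X ->
  exists x1 x2 x3, X = frame x1 x2 x3).
Context (g : operator -> operator -> Coo) (tg : tensor02 g).
Context (sg : forall X Y, vector_field X -> vector_field Y -> g X Y = g Y X).
Context (g11 : g e1 e1 = 1) (g22 : g e2 e2 = 1) (g33 : g e3 e3 = -1).
Context (g12 : g e1 e2 = 0) (g13 : g e1 e3 = 0) (g23 : g e2 e3 = 0).

Let lg Z : vector_field Z -> function_linear (g^~ Z).
Proof. by move=> vZ f X Y vX vY; apply: tg.1. Qed.

Lemma metric_frame1 x1 x2 x3 : g (frame x1 x2 x3) e1 = x1.
Proof.
by rewrite (frame_linear _ _ _ (lg v1)) (sg v2 v1) // (sg v3 v1) // g11 g12 g13;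
  ring.
Qed.

Lemma metric_frame2 x1 x2 x3 : g (frame x1 x2 x3) e2 = x2.
Proof.
by rewrite (frame_linear _ _ _ (lg v2)) (sg v3 v2) // g12 g22 g23; ring.
Qed.

Lemma metric_frame3 x1 x2 x3 : g (frame x1 x2 x3) e3 = - x3.
Proof. by rewrite (frame_linear _ _ _ (lg v3)) g13 g23 g33; ring. Qed.

Lemma frame_coordinates X : vector_field X ->
  X = frame (g X e1) (g X e2) (- g X e3).
Proof.
move=> /span[x1 [x2 [x3 ->]]].
by rewrite metric_frame1 metric_frame2 metric_frame3 opprK.
Qed.

Context (nabla : operator -> operator -> operator) (LC : levi_civita g nabla).

Let vnabla X Y : vector_field X -> vector_field Y -> vector_field (nabla X Y).
Proof. by have [[+ _ _ _] _ _] := LC; apply. Qed.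

(** The connection matrix of a metric connection is skew. *)
Lemma nabla_skew X Y Z : vector_field X -> vector_field Y -> vector_field Z ->
  X (g Y Z) = 0 -> g (nabla X Y) Z = - g (nabla X Z) Y.
Proof.
move=> vX vY vZ gYZ; have [_ _ /(_ X Y Z vX vY vZ)] := LC.
rewrite /cov_deriv02 gYZ sub0r (sg vY); last exact: vnabla.
by move/eqP; rewrite subr_eq0 eqr_oppLR => /eqP.
Qed.

Lemma nabla_unit X Y : vector_field X -> vector_field Y ->
  X (g Y Y) = 0 -> g (nabla X Y) Y = 0.
Proof.
by move=> vX vY gYY; apply: eq_oppr0; exact: nabla_skew.
Qed.

(** The rotation speed of the plane span(e1, e2) under nabla: the one entry of
the connection matrix that survives in the canonical connection. *)
Definition conn_form X := g (nabla X e1) e2.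

(** By skewness the connection matrix has only three independent entries,
[conn_form X], p and q. *)
Lemma nabla_frame X y1 y2 y3 : vector_field X ->
  let p := g (nabla X e3) e1 in let q := g (nabla X e3) e2 in
  nabla X (frame y1 y2 y3) =
  frame (X y1 - conn_form X * y2 + p * y3) (X y2 + conn_form X * y1 + q * y3)
        (X y3 + p * y1 + q * y2).
Proof.
move=> vX p q; have [[_ _ nD nM] _ _] := LC.
have X0 := vector_field_zero vX; have X1 := vector_field_one vX.
have n1 : nabla X e1 = frame 0 (conn_form X) p.
  rewrite [LHS]frame_coordinates; last exact: vnabla.
  by rewrite nabla_unit ?g11 // (@nabla_skew X e1 e3) ?g13 // opprK.
have n2 : nabla X e2 = frame (- conn_form X) 0 q.
  rewrite [LHS]frame_coordinates; last exact: vnabla.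
  rewrite nabla_unit ?g22 // (@nabla_skew X e2 e3) ?g23 // opprK.
  by rewrite (@nabla_skew X e2 e1) // sg // g12.
have n3 : nabla X e3 = frame p q 0.
  rewrite [LHS]frame_coordinates; last exact: vnabla.
  rewrite nabla_unit ?g33 ?oppr0 // vector_fieldN // X1; exact: oppr0.
rewrite [frame y1 y2 y3]/frame !nD ?nM //; do ?exact: vector_field_vscale.
  rewrite n1 n2 n3; apply/funext => h.
  rewrite !(operatorDE, vscaleE, frameE); ring.
by apply: vector_fieldD; exact: vector_field_vscale.
Qed.

Context (J : operator -> operator) (pJ : product_structure J).
Context (J1 : J e1 = e1) (J2 : J e2 = e2) (J3 : J e3 = - e3).

Lemma J_frame x1 x2 x3 : J (frame x1 x2 x3) = frame x1 x2 (- x3).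
Proof.
have lJ h : function_linear (fun X => J X h).
  by move=> f X Y vX vY; rewrite pJ.1.2.
apply/funext => h; rewrite (frame_linear _ _ _ (lJ h)) J1 J2 J3 frameE.
by rewrite operatorNE; ring.
Qed.

Local Notation D := (canonical_connection nabla J).

(** The canonical connection averages nabla with its conjugate by J, which
removes the entries of the connection matrix that mix the two eigenspaces of J;
only the rotation by [conn_form] inside span(e1, e2) remains. *)
Lemma canonical_frame X y1 y2 y3 : vector_field X ->
  D X (frame y1 y2 y3) =
  frame (X y1 - conn_form X * y2) (X y2 + conn_form X * y1) (X y3).
Proof.
move=> vX; rewrite /canonical_connection /cov_deriv11 !J_frame opprK.
rewrite !nabla_frame // J_frame frameB.
set p := g (nabla X e3) e1; set q := g (nabla X e3) e2.
rewrite (_ : frame (_ - _) _ _ = frame (p * y3 + p * y3) (q * y3 + q * y3)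
  (p * y1 + q * y2 + (p * y1 + q * y2))); last first.
  by rewrite (vector_fieldN _ vX); congr frame; ring.
rewrite half_frame frameB; congr frame; ring.
Qed.

Lemma conn_form_linear : function_linear conn_form.
Proof.
move=> f X Y vX vY; have [[_ nD _ _] _ _] := LC.
by rewrite /conn_form nD // tg.1 //; exact: vnabla.
Qed.

(** Torsion-freeness writes the bracket through nabla, which avoids the symmetry
of second derivatives. *)
Lemma vector_field_lie_bracket X Y :
  vector_field X -> vector_field Y -> vector_field (lie_bracket X Y).
Proof.
move=> vX vY; have [_ <- // _] := LC.
by apply: vector_fieldB; exact: vnabla.
Qed.

(** The exterior derivative of the connection form: rotations of a plane
commute, so the quadratic term of the structure equation vanishes. *)
Definition curv_form X Y :=
  X (conn_form Y) - Y (conn_form X) - conn_form (lie_bracket X Y).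

Lemma curvature_frame X Y z1 z2 z3 : vector_field X -> vector_field Y ->
  curvature D X Y (frame z1 z2 z3) =
  frame (- curv_form X Y * z2) (curv_form X Y * z1) 0.
Proof.
move=> vX vY; have vXY := vector_field_lie_bracket vX vY.
rewrite /curvature !canonical_frame // !frameB.
rewrite !(vector_fieldM _ _ vX, vector_fieldM _ _ vY,
  vector_field_additive _ _ vX, vector_field_additive _ _ vY,
  vector_fieldN _ vX, vector_fieldN _ vY).
by rewrite /curv_form /lie_bracket; congr frame; ring.
Qed.

Lemma curv_form_linear Y : vector_field Y -> function_linear (curv_form^~ Y).
Proof.
move=> vY f X X' vX vX'.
have vXY := vector_field_lie_bracket vX vY.
have vX'Y := vector_field_lie_bracket vX' vY.
rewrite /curv_form conn_form_linear // (_ : lie_bracket _ _ =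
  vscale f (lie_bracket X Y) + (vscale (- Y f) X + lie_bracket X' Y)).
  rewrite !conn_form_linear //; last first.
    by apply: vector_fieldD => //; exact: vector_field_vscale.
  rewrite (vector_field_additive _ _ vY) (vector_fieldM _ _ vY).
  by rewrite !(operatorDE, vscaleE); ring.
apply/funext => h; rewrite /lie_bracket !(operatorDE, operatorNE, vscaleE).
rewrite (vector_field_additive _ _ vY) (vector_fieldM _ _ vY); ring.
Qed.

Lemma ricci_frame X y1 y2 y3 : vector_field X ->
  ricci g D e1 e2 e3 X (frame y1 y2 y3) =
  curv_form X e1 * y2 - curv_form X e2 * y1.
Proof.
move=> vX; rewrite /ricci !curvature_frame //.
by rewrite metric_frame1 metric_frame2 metric_frame3; ring.
Qed.

Context (a b c : R).
Local Notation ca := (a *: (1 : Coo)).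
Local Notation cb := (b *: (1 : Coo)).
Local Notation cc := (c *: (1 : Coo)).
Context (h12 : lie_bracket e1 e2 = c *: e2 - b *: e3).
Context (h13 : lie_bracket e1 e3 = - b *: e2 - c *: e3).
Context (h23 : lie_bracket e2 e3 = a *: e1).

Let br12 : lie_bracket e1 e2 = frame 0 cc (- cb).
Proof.
rewrite h12; apply/funext => h.
by rewrite frameE operatorDE operatorNE !operatorZE; ring.
Qed.

Let br13 : lie_bracket e1 e3 = frame 0 (- cb) (- cc).
Proof.
rewrite h13; apply/funext => h.
rewrite frameE operatorDE operatorNE !operatorZE scaleNr; ring.
Qed.

Let br23 : lie_bracket e2 e3 = frame ca 0 0.
Proof. rewrite h23; apply/funext => h; rewrite frameE operatorZE; ring. Qed.

Lemma nabla_torsion X Y Z : vector_field X -> vector_field Y ->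
  vector_field Z -> g (nabla X Y) Z = g (nabla Y X) Z + g (lie_bracket X Y) Z.
Proof.
move=> vX vY vZ; have [_ torsion _] := LC.
have vYX := vnabla vY vX; have vXY := vector_field_lie_bracket vX vY.
have := lg vZ 1 vYX vXY; rewrite mul1r => <-; congr g.
rewrite -torsion //; apply/funext => h.
by rewrite !(operatorDE, operatorNE) vscaleE; ring.
Qed.

Let conn_form1 : conn_form e1 = 0.
Proof.
have X0 := vector_field_zero v1.
rewrite /conn_form nabla_skew ?g12 // nabla_torsion // nabla_unit ?g11 //.
  by rewrite br12 metric_frame1; ring.
exact: vector_field_one.
Qed.

Let conn_form2 : conn_form e2 = - cc.
Proof.
have := nabla_torsion v1 v2 v2; rewrite br12 metric_frame2 nabla_unit ?g22 //.
  by move/esym/eqP; rewrite addr_eq0 => /eqP.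
exact: vector_field_one.
Qed.

(** With u = g (nabla_e1 e2) e3, v = g (nabla_e2 e1) e3, t = conn_form e3, the
torsion identities read - u = t - b, u = v + b and - v = - t + a; eliminating
u and v leaves t + t = a. *)
Let conn_form3 : conn_form e3 = 2^-1 *: ca.
Proof.
have [X1 X2 X3] := And3 (vector_field_zero v1) (vector_field_zero v2)
  (vector_field_zero v3).
have t1 := nabla_torsion v1 v3 v2; have t2 := nabla_torsion v1 v2 v3.
have t3 := nabla_torsion v2 v3 v1.
rewrite br13 metric_frame2 nabla_skew ?(sg v3 v2) ?g23 // in t1.
rewrite br12 metric_frame3 in t2.
rewrite br23 metric_frame1 nabla_skew ?(sg v3 v1) ?g13 // in t3.
rewrite (@nabla_skew e3 e2 e1) ?(sg v2 v1) ?g12 // in t3.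
rewrite -/(conn_form e3) in t1 t3; rewrite t2 in t1.
rewrite -[LHS]halfD; congr (_ *: _); apply/eqP; rewrite -subr_eq0; apply/eqP.
have -> : conn_form e3 + conn_form e3 - ca =
    (conn_form e3 - cb - - (g (nabla e2 e1) e3 + - - cb)) -
    (- conn_form e3 + ca - - g (nabla e2 e1) e3) by ring.
by rewrite -t1 -t3 !subrr.
Qed.

Lemma curv_form_anti X Y : vector_field X -> vector_field Y ->
  curv_form Y X = - curv_form X Y.
Proof.
move=> vX vY; rewrite /curv_form.
rewrite (_ : lie_bracket Y X = vscale (-1) (lie_bracket X Y)).
  rewrite (function_linearZ _ conn_form_linear); first by ring.
  exact: vector_field_lie_bracket.
by apply/funext => h; rewrite vscaleE /lie_bracket; ring.
Qed.

Local Notation k := (c ^+ 2 + a * b / 2).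
Local Notation m := (c * (a / 2 - b) / 2).

Let conn_form_frame x1 x2 x3 :
  conn_form (frame x1 x2 x3) = - cc * x2 + (a / 2) *: (1 : Coo) * x3.
Proof.
rewrite (frame_linear _ _ _ conn_form_linear) conn_form1 conn_form2 conn_form3.
rewrite scalerA mulrC.
by rewrite (mulrC 2^-1); ring.
Qed.

Let curv_form12 : curv_form e1 e2 = k *: (1 : Coo).
Proof.
rewrite /curv_form conn_form1 conn_form2 br12 conn_form_frame.
rewrite (vector_fieldN _ v1).
rewrite (vector_field_scalar _ v1) (vector_field_zero v2).
apply: smooth_fun_ext => p; rewrite -[RHS]/(k * 1).
rewrite -[LHS]/(- 0 - 0 - (- (c * 1) * (c * 1) + a / 2 * 1 * - (b * 1))).
by field.
Qed.

Let curv_form13 : curv_form e1 e3 = m *: (1 : Coo) + m *: (1 : Coo).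
Proof.
rewrite /curv_form conn_form1 conn_form3 scalerA br13 conn_form_frame.
rewrite (vector_field_scalar _ v1) (vector_field_zero v3).
apply: smooth_fun_ext => p; rewrite -[RHS]/(m * 1 + m * 1).
rewrite -[LHS]/(0 - 0 - (- (c * 1) * - (b * 1) + a / 2 * 1 * - (c * 1))).
by field.
Qed.

Let curv_form23 : curv_form e2 e3 = 0.
Proof.
rewrite /curv_form conn_form2 conn_form3 scalerA (vector_fieldN _ v3).
rewrite (vector_field_scalar _ v3) (vector_field_scalar _ v2) br23.
by rewrite conn_form_frame; ring.
Qed.

Lemma sym_ricci_frame x1 x2 x3 y1 y2 y3 :
  sym_ricci g D e1 e2 e3 (frame x1 x2 x3) (frame y1 y2 y3) =
  - (k *: (1 : Coo)) * (x1 * y1 + x2 * y2)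
  - m *: (1 : Coo) * (x2 * y3 + x3 * y2).
Proof.
have vx := vector_field_frame x1 x2 x3; have vy := vector_field_frame y1 y2 y3.
have curv_form0 X : vector_field X -> curv_form X X = 0.
  by move=> vX; apply: eq_oppr0; exact: curv_form_anti.
have r z1 z2 z3 z1' z2' z3' : ricci g D e1 e2 e3 (frame z1 z2 z3)
    (frame z1' z2' z3') = - (k *: (1 : Coo)) * (z1 * z1' + z2 * z2')
                           - (m *: (1 : Coo) + m *: (1 : Coo)) * (z3 * z2').
  rewrite ricci_frame // (frame_linear _ _ _ (curv_form_linear v1)).
  rewrite (frame_linear _ _ _ (curv_form_linear v2)) !curv_form0 //.
  rewrite (curv_form_anti v1 v2) (curv_form_anti v1 v3) (curv_form_anti v2 v3).
  by rewrite curv_form12 curv_form13 curv_form23; ring.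
rewrite /sym_ricci !r -[RHS]halfD; congr (_ *: _).
by ring.
Qed.

(** Rotations of span(e1, e2) preserve x1 y1 + x2 y2, so only the second term of
[sym_ricci_frame] contributes. *)
Lemma cov_deriv_sym_ricci X y1 y2 y3 z1 z2 z3 : vector_field X ->
  cov_deriv02 D (sym_ricci g D e1 e2 e3) X (frame y1 y2 y3) (frame z1 z2 z3) =
  m *: (1 : Coo) * conn_form X * (y1 * z3 + y3 * z1).
Proof.
move=> vX; rewrite /cov_deriv02 !canonical_frame // !sym_ricci_frame.
rewrite !(vector_fieldM _ _ vX, vector_field_additive _ _ vX,
  vector_fieldN _ vX, vector_field_scalar _ vX).
by ring.
Qed.

(** The point p turns the vanishing of a constant function into that of its
value. *)
Lemma codazzi_sym_ricci (p : M) : c != 0 ->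
  codazzi D (sym_ricci g D e1 e2 e3) <-> a = 2 * b.
Proof.
move=> c0; split=> [cod|ab X Y Z vX vY vZ].
  have := cod _ _ _ (vector_field_frame 1 0 0) (vector_field_frame 0 1 0)
    (vector_field_frame 0 0 1).
  rewrite !cov_deriv_sym_ricci // -frame100 -frame010 conn_form1.
  rewrite conn_form2 => cod0.
  have mc0 : m *: (1 : Coo) * cc = 0 by rewrite -[RHS]cod0; ring.
  have mc : m * c = 0.
    have := congr1 (fun f : Coo => f p) mc0.
    by rewrite -[LHS]/(m * 1 * (c * 1)) !mulr1.
  have -> : a = 2 * b + 4 * (m * c) / c ^+ 2 by field.
  by rewrite mc mulr0 mul0r addr0.
have m0 : m = 0 by rewrite ab; field.
have [y1 [y2 [y3 ->]]] := span vY.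
have [x1 [x2 [x3 ->]]] := span vX; have [z1 [z2 [z3 ->]]] := span vZ.
by rewrite !cov_deriv_sym_ricci // m0 scale0r; ring.
Qed.

End frame_geometry.

(** * The Codazzi condition on the group *)

Theorem theorem4p6 (R : realType) (alpha beta gamma : R) (hgamma : gamma != 0)
  (G : topGroupType) (L : lie_group R 3 G)
  (hconn : connected [set: G]) (hsimply : simply_connected R G)
  (e1 e2 e3 : smooth_fun L -> smooth_fun L)
  (hbasis : lie_algebra_basis3 e1 e2 e3)
  (h12 : lie_bracket e1 e2 = gamma *: e2 - beta *: e3)
  (h13 : lie_bracket e1 e3 = - beta *: e2 - gamma *: e3)
  (h23 : lie_bracket e2 e3 = alpha *: e1)
  (g : (smooth_fun L -> smooth_fun L) -> (smooth_fun L -> smooth_fun L) ->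
       smooth_fun L)
  (hg : lorentzian3 g) (hginv : left_invariant_metric g)
  (hortho : forall p, pseudo_orthonormal g e1 e2 e3 p)
  (nablaL : (smooth_fun L -> smooth_fun L) -> (smooth_fun L -> smooth_fun L) ->
            (smooth_fun L -> smooth_fun L))
  (hLC : levi_civita g nablaL)
  (J : (smooth_fun L -> smooth_fun L) -> (smooth_fun L -> smooth_fun L))
  (hJ : product_structure J)
  (hJ1 : J e1 = e1) (hJ2 : J e2 = e2) (hJ3 : J e3 = - e3) :
  codazzi (canonical_connection nablaL J)
    (sym_ricci g (canonical_connection nablaL J) e1 e2 e3)
  <-> gamma != 0 /\ alpha = 2 * beta.
Proof.
move=> {hconn hsimply hginv}.
have [[[v1 i1] [v2 i2] [v3 i3] basis] [tg sg _]] := conj hbasis hg.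
pose e (i : 'I_3) := nth 0 [:: e1; e2; e3] i.
have e_sum (F : 'I_3 -> smooth_fun L -> smooth_fun L) :
    \sum_i F i = F ord0 + (F (lift ord0 ord0) + F (lift ord0 (lift ord0 ord0))).
  by rewrite !big_ord_recl big_ord0 addr0.
have e_lie i : lie_algebra (e i).
  by case: i => -[|[|[|//]]].
have e_free (v : 'rV[R]_3) : \sum_i v 0 i *: e i = 0 -> v = 0.
  move=> v0; have lie0 : lie_algebra (0 : smooth_fun L -> smooth_fun L).
    by split; first exact: vector_field0.
  have [x [_ x_unique]] := basis 0 lie0.
  pose s (t : 'rV[R]_3) := (t 0 ord0, t 0 (lift ord0 ord0),
                             t 0 (lift ord0 (lift ord0 ord0))).
  have xv : x = s v by apply: x_unique; rewrite -v0 e_sum addrA.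
  have x0 : x = s 0 by apply: x_unique; rewrite /s /= !mxE !scale0r !addr0.
  move: x0; rewrite xv => -[v0_ v1_ v2_]; apply/rowP => i.
  case: (unliftP ord0 i) => [j ->|-> //].
  by case: (unliftP ord0 j) => [l ->|-> //]; rewrite (ord1 l).
have span X : vector_field X -> exists x1 x2 x3, X = frame e1 e2 e3 x1 x2 x3.
  move=> /(frame_expansion e_lie e_free)[x ->].
  exists (x ord0), (x (lift ord0 ord0)), (x (lift ord0 (lift ord0 ord0))).
  by rewrite e_sum.
have g11 : g e1 e1 = 1.
  by apply: smooth_fun_ext => p; have [-> _ _ _] := hortho p.
have g22 : g e2 e2 = 1.
  by apply: smooth_fun_ext => p; have [_ -> _ _] := hortho p.
have g33 : g e3 e3 = -1.
  by apply: smooth_fun_ext => p; have [_ _ -> _] := hortho p.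
have g12 : g e1 e2 = 0.
  by apply: smooth_fun_ext => p; have [_ _ _ [-> _ _ _]] := hortho p.
have g13 : g e1 e3 = 0.
  by apply: smooth_fun_ext => p; have [_ _ _ [_ _ -> _]] := hortho p.
have g23 : g e2 e3 = 0.
  by apply: smooth_fun_ext => p; have [_ _ _ [_ _ _ [_ -> _]]] := hortho p.
apply: iff_trans (codazzi_sym_ricci v1 v2 v3 span tg sg g11 g22 g33 g12 g13 g23
  hLC hJ hJ1 hJ2 hJ3 h12 h13 h23 1%g hgamma) _.
by split=> [|[]].
Qed.
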